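(* Let $\Gamma$ be a positive affine semigroup, and let $S\in\mathbb{Z}_+^{k\times l}$ be its slack matrix. Then $\Gamma\cong\Gamma_S^{\mathrm{row}}$ and $\Gamma^*\cong\Gamma_S^{\mathrm{col}}$ (as semigroups), where the isomorphisms are given by sending each minimal generator of $\Gamma$ or $\Gamma^*$ to the corresponding row or column, respectively, of the slack matrix.
   Context: $\mathbb{Z}_+$ denotes the nonnegative integers. An affine semigroup is a set $\Gamma=\{\sum_{i=1}^k m_iv_i \mid m_i\in\mathbb{Z}_+\}\subseteq\mathbb{R}^n$, for some $v_1,\dots,v_k\in\mathbb{R}^n$, such that $\Lambda_\Gamma=\{x-y\mid x,y\in\Gamma\}$ is a lattice (a discrete additive subgroup of $\mathbb{R}^n$). It is positive if $0$ is the only $x\in\Gamma$ with $-x\in\Gamma$. A positive affine semigroup has a unique minimal generating set. The dual of $\Gamma$ is $\Gamma^*=\{w\in\operatorname{span}(\Gamma)\mid \langle w,a\rangle\in\mathbb{Z}_+\text{ for all }a\in\Gamma\}$; for positive $\Gamma$ it is again a positive affine semigroup. Slack matrix: if $a_1,\dots,a_k$ and $b_1,\dots,b_l$ are the minimal generating sets of $\Gamma$ and $\Gamma^*$, the slack matrix of $\Gamma$ is the matrix in $\mathbb{Z}_+^{k\times l}$ with $(i,j)$-entry $\langle a_i,b_j\rangle$ (row $i$ corresponds to $a_i$, column $j$ to $b_j$). For an integer matrix $M\in\mathbb{Z}^{n\times m}$, $\Gamma_M^{\mathrm{row}}\subseteq\mathbb{Z}^m$ and $\Gamma_M^{\mathrm{col}}\subseteq\mathbb{Z}^n$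 denote the semigroups of all nonnegative integer combinations of the rows and of the columns of $M$, respectively. *)

(* Defs.v *)
From mathcomp Require Import all_boot all_order all_algebra.
From mathcomp Require Import all_classical all_reals all_analysis.

Set Implicit Arguments.
Unset Strict Implicit.
Unset Printing Implicit Defensive.

Import Order.TTheory GRing.Theory Num.Theory.
Import numFieldNormedType.Exports.

Local Open Scope classical_set_scope.
Local Open Scope ring_scope.

Definition nat_combs (V : nmodType) (k : nat) (v : 'I_k -> V) : set V :=
  [set x | exists m : 'I_k -> nat, x = \sum_(i < k) v i *+ m i].

Definition generated (V : nmodType) (A : set V) : set V :=
  [set x | exists (k : nat) (v : 'I_k -> V),
     (forall i, A (v i)) /\ nat_combs v x].

(* Minimality is with respect to inclusion; A is not assumed finite. *)
Definition minimal_generating_set (V : nmodType) (G A : set V) : Prop :=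
  generated A = G /\
  forall B : set V, B `<=` A -> generated B = G -> B = A.

Definition enumerates_min_gens (V : nmodType) (G : set V) (k : nat)
    (a : 'I_k -> V) : Prop :=
  injective a /\ minimal_generating_set G (range a).

(* f is a total function, but only its restriction to G matters.  Preservation
   of 0 follows, since G and H are submonoids of groups in all uses. *)
Definition semigroup_iso (V W : nmodType) (G : set V) (H : set W)
    (f : V -> W) : Prop :=
  set_bij G H f /\ {in G &, {morph f : x y / x + y}}.

Section RealSpace.
Context {R : realType} {n : nat}.
Implicit Types (G L : set 'rV[R]_n) (u v w : 'rV[R]_n).

Definition dot u v : R := \sum_(i < n) u 0 i * v 0 i.

Definition linear_span G : set 'rV[R]_n :=
  [set x | exists (m : nat) (c : 'I_m -> R) (v : 'I_m -> 'rV[R]_n),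
     (forall i, G (v i)) /\ x = \sum_(i < m) c i *: v i].

Definition lattice L : Prop := zmod_closed (mem L) /\ L `<=` isolated L.

Definition differences G : set 'rV[R]_n :=
  [set z | exists x y, [/\ G x, G y & z = x - y]].

Definition affine_semigroup G : Prop :=
  (exists (k : nat) (v : 'I_k -> 'rV[R]_n), G = nat_combs v) /\
  lattice (differences G).

Definition positive_affine_semigroup G : Prop :=
  affine_semigroup G /\ forall x, G x -> G (- x) -> x = 0.

Definition dual G : set 'rV[R]_n :=
  [set w | linear_span G w /\ forall a, G a -> dot w a \is a Num.nat].

(* The slack matrix depends on a choice of order on the two minimal generating
   sets; that choice is recorded by the enumerations a and b. *)
Definition is_slack_matrix G (k l : nat)
    (a : 'I_k -> 'rV[R]_n) (b : 'I_l -> 'rV[R]_n) (S : 'M[int]_(k, l)) : Prop :=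
  [/\ enumerates_min_gens G a, enumerates_min_gens (dual G) b
    & forall i j, 0 <= S i j /\ (S i j)%:~R = dot (a i) (b j)].

End RealSpace.

Definition row_semigroup (n m : nat) (M : 'M[int]_(n, m)) : set 'rV[int]_m :=
  nat_combs (fun i : 'I_n => row i M).

Definition col_semigroup (n m : nat) (M : 'M[int]_(n, m)) : set 'cV[int]_n :=
  nat_combs (fun j : 'I_m => col j M).

(* Main.v *)
(** Sending x to (<x, b_j>)_j is additive and maps a_i to row i of S, so only
    injectivity needs work.  On the dual it is clear, because dual vectors lie
    in span(G).  On G it says that the dual separates points.  Choose linearly
    independent generators spanning span(G); since differences(G) is discrete,
    Dirichlet approximation shows that all generators have rational coordinates
    with respect to them.  If the dual does not see the difference z of two
    elements of G, then by Farkas' lemma over the rationals both z and -z lie in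
    the rational cone of the generators, so some positive multiples of z and -z
    both lie in G, and positivity forces z = 0. *)
Require Import Defs.
From mathcomp Require Import all_boot all_order all_algebra.
From mathcomp Require Import all_classical all_reals all_analysis.

Set Implicit Arguments.
Unset Strict Implicit.
Unset Printing Implicit Defensive.

Import Order.TTheory GRing.Theory Num.Theory.
Import numFieldNormedType.Exports.

Local Open Scope classical_set_scope.
Local Open Scope ring_scope.

(** * Semigroups of nonnegative integer combinations *)

Lemma nat_combs0 (V : nmodType) (k : nat) (a : 'I_k -> V) : nat_combs a 0.
Proof. by exists (fun=> 0%N); rewrite big1. Qed.

Lemma nat_combsD (V : nmodType) (k : nat) (a : 'I_k -> V) (x y : V) :
  nat_combs a x -> nat_combs a y -> nat_combs a (x + y).
Proof.
move=> [m ->] [p ->]; exists (fun i => (m i + p i)%N).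
by rewrite -big_split; apply: eq_bigr => i _; rewrite mulrnDr.
Qed.

Lemma nat_combs_gen (V : nmodType) (k : nat) (a : 'I_k -> V) (i : 'I_k) :
  nat_combs a (a i).
Proof.
exists (fun j => nat_of_bool (j == i)).
rewrite (bigD1 i)//= eqxx mulr1n big1 ?addr0// => j /negbTE->.
by rewrite mulr0n.
Qed.

Lemma nat_combsMn (V : nmodType) (k : nat) (a : 'I_k -> V) (x : V) (n : nat) :
  nat_combs a x -> nat_combs a (x *+ n).
Proof.
move=> ax; elim: n => [|n IH]; first by rewrite mulr0n; exact: nat_combs0.
by rewrite mulrS; apply: nat_combsD.
Qed.

Lemma generated_range (V : nmodType) (k : nat) (a : 'I_k -> V) :
  generated (range a) = nat_combs a.
Proof.
apply/seteqP; split=> [x [p [v [av [m ->]]]]|x ax]; last first.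
  by exists k, a; split=> // i; exists i.
apply: (big_ind (nat_combs a)); [exact: nat_combs0|exact: nat_combsD|move=> i _].
apply: nat_combsMn; have [j _ <-] := av i; exact: nat_combs_gen.
Qed.

Lemma min_gens_nat_combs (V : nmodType) (G : set V) (k : nat) (a : 'I_k -> V) :
  enumerates_min_gens G a -> G = nat_combs a.
Proof. by move=> [_ [<- _]]; exact: generated_range. Qed.

(** Cancellation in [W] forces [f 0 = 0], so [f] commutes with all combinations; this gives both the
    image and surjectivity. *)
Lemma nat_combs_iso (V W : zmodType) (k : nat) (a : 'I_k -> V) (c : 'I_k -> W)
    (f : V -> W) :
  {in nat_combs a &, {morph f : x y / x + y}} -> (forall i, f (a i) = c i) ->
  {in nat_combs a &, injective f} ->
  semigroup_iso (nat_combs a) (nat_combs c) f.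
Proof.
(* [K] is the graph of [f] over the semigroup; additivity is known only there, so the induction on
   sums carries membership along. *)
move=> fD fa finj; pose K x y := nat_combs a x /\ f x = y.
have K0 : K 0 0.
  split; first exact: nat_combs0.
  have /(congr1 (fun t => t - f 0)) := fD 0 0 (mem_set (nat_combs0 a))
    (mem_set (nat_combs0 a)).
  by rewrite addr0 addrK subrr.
have KD x1 x2 y1 y2 : K x1 x2 -> K y1 y2 -> K (x1 + y1) (x2 + y2).
  move=> [ax <-] [ay <-]; split; first exact: nat_combsD.
  by rewrite fD ?inE.
have fE (m : 'I_k -> nat) : f (\sum_i a i *+ m i) = \sum_i c i *+ m i.
  apply: (proj2 (_ : K _ _)); apply: (big_ind2 K) => // i _.
  elim: (m i) => [//|p IH]; rewrite !mulrS; apply: KD => //.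
  by split=> //; exact: nat_combs_gen.
split=> //; split.
- by move=> _ [m ->] /=; exists m; rewrite fE.
- exact: finj.
- by move=> _ [m ->]; exists (\sum_i a i *+ m i); [exists m|rewrite fE].
Qed.

(** * Dirichlet approximation and rational coordinates *)

(** Pigeonhole: the unit cube is cut into [q.+1 ^ r] boxes, and of one more multiple of [c] than
    there are boxes, two have fractional parts in the same box; subtract them. *)
Lemma simultaneous_approx (R : archiRealFieldType) (r q : nat) (c : 'I_r -> R) :
  exists (N : nat) (p : 'I_r -> int),
    (0 < N)%N /\ forall i, `|c i *+ N - (p i)%:~R| < q.+1%:R^-1.
Proof.
pose fr (x : R) := x - (Num.floor x)%:~R.
have fr01 x : 0 <= fr x < 1.
  have /andP[h1 h2] := floor_itv x.
  by rewrite /fr subr_ge0 h1 ltrBlDl; rewrite intrD in h2.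
pose box (N : nat) : {ffun 'I_r -> 'I_q.+1} :=
  [ffun i => inord (Num.truncn (q.+1%:R * fr (c i *+ N)))].
pose F (N : 'I_(q.+1 ^ r).+1) := box N.
have /injectivePn [M [N neqMN eqF]] : ~~ injectiveb F.
  by apply/injectiveP => /leq_card; rewrite card_ffun !card_ord ltnn.
wlog ltMN : M N neqMN eqF / (M < N)%N.
  move=> h; have [lt|lt|eq] := ltngtP M N; first exact: (h M N).
    by apply: (h N M) => //; rewrite eq_sym.
  by rewrite (val_inj eq) eqxx in neqMN.
exists (N - M)%N, (fun i => Num.floor (c i *+ N) - Num.floor (c i *+ M)).
split=> [|i]; first by rewrite subn_gt0.
have -> : c i *+ (N - M) - (Num.floor (c i *+ N) - Num.floor (c i *+ M))%:~R
    = fr (c i *+ N) - fr (c i *+ M).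
  by rewrite mulrnBr 1?ltnW// intrB /fr !opprD addrACA.
(* The index stays below [q.+1], so [inord] in [box] never takes its default value. *)
have tr (P : nat) : (Num.truncn (q.+1%:R * fr (c i *+ P)) < q.+1)%N.
  have /andP[h0 h1] := fr01 (c i *+ P).
  by rewrite truncn_lt_nat ?mulr_ge0// gtr_pMr.
have : Num.truncn (q.+1%:R * fr (c i *+ M)) = Num.truncn (q.+1%:R * fr (c i *+ N)).
  by have /ffunP/(_ i)/(congr1 val) := eqF; rewrite !ffunE /= !inordK.
have /andP[hM _] := fr01 (c i *+ M); have /andP[hN _] := fr01 (c i *+ N).
have /truncn_itv/andP[] : 0 <= q.+1%:R * fr (c i *+ M) by rewrite mulr_ge0.
have /truncn_itv/andP[] : 0 <= q.+1%:R * fr (c i *+ N) by rewrite mulr_ge0.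
move=> N1 N2 M1 M2 eqt; rewrite eqt in M1 M2; move: N2 M2.
rewrite -[in X in _ < X -> _]natr1 -[in X in _ -> _ < X -> _]natr1 => N2 M2.
rewrite -[X in _ < X]mul1r ltr_pdivlMr// mulrC.
rewrite -[X in X * _]ger0_norm// -normrM mulrBr ltr_norml ltrBrDl ltrBlDl.
apply/andP; split.
  by rewrite (lt_le_trans M2)// addrC lerD2l.
by rewrite ltrBlDl (lt_le_trans N2)// lerD2r.
Qed.

(** If [N c - p] is small, then [(N c - p) U] is a lattice vector near 0, hence 0 by discreteness;
    independence of the rows gives [N c = p]. *)
Lemma lattice_coords_rat (R : realType) (n r : nat) (L : set 'rV[R]_n)
    (U : 'M[R]_(r, n)) (c : 'rV[R]_r) :
  lattice L -> row_free U -> (forall i, L (row i U)) -> L (c *m U) ->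
  exists d : 'rV[rat]_r, c = map_mx ratr d.
Proof.
move=> [[L0 LB] Liso] Ufree LU LcU.
have {}LB x y : L x -> L y -> L (x - y).
  by move=> Lx Ly; have := LB x y; rewrite !inE; apply.
have {}L0 : L 0 by have := L0; rewrite inE.
have LN x : L x -> L (- x) by move=> Lx; rewrite -[- x]add0r; apply: LB.
have LD x y : L x -> L y -> L (x + y).
  by move=> Lx Ly; rewrite -[y]opprK; apply: LB => //; apply: LN.
have LMn x (m : nat) : L x -> L (x *+ m).
  by move=> Lx; elim: m => [//|m IH]; rewrite mulrS; apply: LD.
have LMz x (m : int) : L x -> L (x *~ m).
  by move=> Lx; case: m => m; [exact: LMn|apply: LN; exact: LMn].
have [_ [V /nbhs_ballP[e /= e0 eV] VL]] := Liso _ L0.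
(* Coordinate errors below [1 / q.+1] move each entry of [d *m U] by at most [s / q.+1], and this
   [q] makes that less than [e]. *)
pose s := \sum_i \sum_j `|U i j|.
pose q := Num.truncn (s / e).
have [N [p [N0 cp]]] := simultaneous_approx q (fun i => c 0 i).
pose d := \row_i (c 0 i *+ N - (p i)%:~R).
have dU : d *m U = (c *m U) *+ N - \sum_i row i U *~ p i.
  have -> : d = c *+ N - \row_i (p i)%:~R.
    by apply/rowP => i; rewrite !mxE mulmxnE.
  rewrite mulmxBl -[c *+ N]scaler_nat -[c *m U *+ N]scaler_nat -scalemxAl; congr (_ - _).
  rewrite mulmx_sum_row; apply: eq_bigr => i _.
  by rewrite mxE scaler_int.
have LdU : L (d *m U).
  rewrite dU; apply: LB; first exact: LMn.
  by apply: big_ind => // i _; apply: LMz.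
have dU0 : d *m U = 0.
  suff : (V `&` L) (d *m U) by rewrite VL.
  split=> //; apply: eV; split=> [|i j]; first by []; rewrite ord1 mxE.
  rewrite /ball /= sub0r normrN mxE.
  apply: (@le_lt_trans _ _ (q.+1%:R^-1 * s)); last first.
    rewrite mulrC ltr_pdivrMr// mulrC -ltr_pdivrMr//.
    exact: truncnS_gt.
  apply: (le_trans (ler_norm_sum _ _ _)).
  rewrite mulr_sumr; apply: ler_sum => i' _.
  rewrite normrM ler_pM//; first by rewrite mxE ltW.
  by rewrite (bigD1 j)//= lerDl sumr_ge0.
have d0 : d = 0.
  by apply/eqP; move/eqP: dU0; rewrite mulmx_free_eq0.
exists (\row_i ((p i)%:~R / N%:R)); apply/rowP => i.
rewrite !mxE fmorph_div /= ratr_int ratr_nat.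
move/rowP/(_ i): d0; rewrite !mxE => /eqP; rewrite subr_eq0 => /eqP <-.
by rewrite -[c 0 i *+ N]mulr_natr mulfK// pnatr_eq0 -lt0n.
Qed.

(** * Farkas' lemma and clearing denominators *)

(** Induction on the number of inequalities. Allowing any ordered field lets it produce rational
    multipliers later. *)
Lemma farkas (F : realFieldType) (m r : nat) (A : 'M[F]_(m, r)) (g : 'rV[F]_r) :
  (forall x : 'cV_r, (forall i, 0 <= (A *m x) i 0) -> 0 <= (g *m x) 0 0) ->
  exists t : 'rV[F]_m, (forall i, 0 <= t 0 i) /\ g = t *m A.
Proof.
elim: m A g => [|m IH] A g hg.
  (* Without constraints, testing [g] on a unit vector and its negative kills each entry. *)
  exists 0; split=> [[]//|]; rewrite mul0mx; apply/rowP => j.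
  have e (x : 'cV[F]_r) : 0 <= (g *m x) 0 0 by apply: hg => -[].
  have := e (delta_mx j 0); have := e (- delta_mx j 0).
  rewrite mulmxN -colE !mxE oppr_ge0 => h1 h2.
  by apply/eqP; rewrite eq_le h1.
pose al : 'rV_r := usubmx (A : 'M[F]_(1 + m, r)).
pose B : 'M[F]_(m, r) := dsubmx (A : 'M[F]_(1 + m, r)).
have AE : A = col_mx al B by rewrite /al /B vsubmxK.
have hg' (x : 'cV_r) : 0 <= (al *m x) 0 0 -> (forall i, 0 <= (B *m x) i 0) ->
    0 <= (g *m x) 0 0.
  move=> h0 h1; apply: hg => i; rewrite AE.
  rewrite (@mul_col_mx _ 1 m r 1).
  case: (@split_ordP 1 m i) => j ->.
    by rewrite (@col_mxEu _ 1 m) ord1.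
  by rewrite (@col_mxEd _ 1 m).
(* Either the first inequality is redundant and gets multiplier 0, or some [x0] satisfies the others
   with [g x0 < 0], which forces [al x0 < 0]. *)
have [hB|/existsNP[x0 /not_implyP[Bx0 /negP]]] := pselect
  (forall x : 'cV_r, (forall i, 0 <= (B *m x) i 0) -> 0 <= (g *m x) 0 0).
  have [t [t0 ->]] := IH _ _ hB.
  exists (row_mx (0 : 'M[F]_1) t : 'rV_(1 + m)); split=> [i|]; last first.
    by rewrite AE (@mul_row_col _ 1 1 m) mul0mx add0r.
  case: (@split_ordP 1 m i) => j ->.
    by rewrite (@row_mxEl _ 1 1 m) mxE.
  by rewrite (@row_mxEr _ 1 1 m).
rewrite -ltNge => gx0.
have ax0 : (al *m x0) 0 0 < 0.
  by rewrite ltNge; apply/negP => h; have := hg' _ h Bx0; rewrite leNgt gx0.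
set s := - (al *m x0) 0 0; have s0 : 0 < s by rewrite oppr_gt0.
pose x1 := s^-1 *: x0.
have ax1 : al *m x1 = - 1%:M.
  rewrite -scalemxAr; apply/matrixP => i j; rewrite !ord1 !mxE eqxx mulr1n.
  by move: s0; rewrite /s !mxE => s0; rewrite invrN mulNr mulVf// -oppr_eq0 gt_eqF.
have Bx1 i : 0 <= (B *m x1) i 0.
  by rewrite -scalemxAr mxE mulr_ge0// invr_ge0 ltW.
have gx1 : (g *m x1) 0 0 < 0.
  by rewrite -scalemxAr mxE pmulr_rlt0// invr_gt0.
(* Replacing [x] by [x + (al x) x1] makes [al] vanish, which trades the
   constraint [al x >= 0] for a rank-one correction of [B] and [g]. *)
have [x|t [t0 gE]] := IH (B + B *m x1 *m al) (g + g *m x1 *m al).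
  have corr p (C : 'M[F]_(p, r)) :
      (C + C *m x1 *m al) *m x = C *m (x + x1 *m (al *m x)).
    by rewrite mulmxDl mulmxDr !mulmxA.
  rewrite !corr => hx; apply: hg' => //.
  by rewrite mulmxDr mulmxA ax1 mulNmx mul1mx subrr mxE.
(* Expanding [gE] gives [g = t B + (t B x1 - g x1) al]; the new coefficient is nonnegative since [t]
   and [B x1] are and [g x1 < 0]. *)
exists (row_mx (t *m B *m x1 - g *m x1) t : 'rV_(1 + m)); split=> [i|]; last first.
  rewrite AE (@mul_row_col _ 1 1 m) mulmxBl.
  move/eqP: gE; rewrite -subr_eq0 mulmxDr !mulmxA => /eqP gE.
  apply/eqP; rewrite -subr_eq0 -{}gE; apply/eqP.
  by rewrite !opprD !opprK -!addrA; congr (_ + _); rewrite addrC -!addrA addrC -!addrA.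
case: (@split_ordP 1 m i) => j ->.
  rewrite (@row_mxEl _ 1 1 m) ord1 mxE [X in _ + X]mxE subr_ge0.
  rewrite (le_trans (ltW gx1))// -mulmxA mxE sumr_ge0// => i' _.
  exact: mulr_ge0.
by rewrite (@row_mxEr _ 1 1 m).
Qed.

Lemma common_denominator (T : finType) (q : T -> rat) :
  exists N : nat, (0 < N)%N /\ forall t, N%:R * q t \is a Num.int.
Proof.
exists (\prod_t `|denq (q t)|)%N; split=> [|t].
  by apply: prodn_gt0 => t; rewrite absz_gt0 denq_neq0.
rewrite (bigD1 t)//= natrM mulrAC rpredM//; last exact/intr_nat/natr_nat.
rewrite natr_absz ger0_norm ?denq_ge0// mulrC.
by rewrite -numqE intr_int.
Qed.

Lemma common_denominator_nat (T : finType) (q : T -> rat) :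
  (forall t, 0 <= q t) ->
  exists (N : nat) (m : T -> nat), (0 < N)%N /\ forall t, N%:R * q t = (m t)%:R.
Proof.
move=> q0; have [N [N0 hN]] := common_denominator q.
exists N, (fun t => Num.truncn (N%:R * q t)); split=> // t.
by rewrite truncnK// natrEint hN mulr_ge0.
Qed.

(** * Inner products and the Gram matrix *)

Lemma dotE (R : realType) (n : nat) (u v : 'rV[R]_n) : dot u v = (u *m v^T) 0 0.
Proof. by rewrite mxE; apply: eq_bigr => i _; rewrite mxE. Qed.

Lemma dotC (R : realType) (n : nat) (u v : 'rV[R]_n) : dot u v = dot v u.
Proof. by apply: eq_bigr => i _; rewrite mulrC. Qed.

Lemma dotDl (R : realType) (n : nat) (u v w : 'rV[R]_n) :
  dot (u + v) w = dot u w + dot v w.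
Proof. by rewrite !dotE mulmxDl mxE. Qed.

Lemma dotNl (R : realType) (n : nat) (u w : 'rV[R]_n) : dot (- u) w = - dot u w.
Proof. by rewrite !dotE mulNmx mxE. Qed.

Lemma dot_comb (R : realType) (n k : nat) (a : 'I_k -> 'rV[R]_n) (m : 'I_k -> nat)
    (u : 'rV[R]_n) :
  dot (\sum_i a i *+ m i) u = \sum_i dot (a i) u *+ m i.
Proof.
rewrite dotE mulmx_suml summxE; apply: eq_bigr => i _.
by rewrite -[a i *+ m i]scaler_nat -scalemxAl mxE -dotE mulr_natl.
Qed.

Lemma dot_eq0 (R : realType) (n : nat) (u : 'rV[R]_n) : dot u u = 0 -> u = 0.
Proof.
move=> /eqP; rewrite psumr_eq0 => [/allP h|i _]; last exact: sqr_ge0.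
apply/rowP => i; have := h i (mem_index_enum _).
by rewrite mxE mulf_eq0 orbb => /eqP.
Qed.

(** If [c U U^T = 0], then [c U] has norm 0, so [c U = 0] and [c = 0]. *)
Lemma gram_unit (R : realType) (r n : nat) (U : 'M[R]_(r, n)) :
  row_free U -> U *m U^T \in unitmx.
Proof.
move=> Ufree; rewrite -row_free_unit -kermx_eq0; apply/rowV0P => c.
rewrite sub_kermx mulmxA => /eqP cUU; apply/eqP.
rewrite -(mulmx_free_eq0 _ Ufree); apply/eqP/dot_eq0.
by rewrite dotE trmx_mul mulmxA cUU mul0mx mxE.
Qed.

(** * Separation of points by the dual *)

Lemma differences_combs (R : realType) (n k : nat) (a : 'I_k -> 'rV[R]_n) i :
  differences (nat_combs a) (a i).
Proof.
by exists (a i), 0; rewrite subr0; split=> //; [exact: nat_combs_gen|exact: nat_combs0].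
Qed.

Lemma dual_separates (R : realType) (n k : nat) (a : 'I_k -> 'rV[R]_n)
    (x y : 'rV[R]_n) :
  positive_affine_semigroup (nat_combs a) -> nat_combs a x -> nat_combs a y ->
  (forall w, dual (nat_combs a) w -> dot x w = dot y w) -> x = y.
Proof.
move=> [[_ lat] pos] [mx xE] [my yE] dxy.
pose A := \matrix_i a i.
(* The rows of [U] are generators forming a basis of the span; [C] holds the coordinates of all
   generators, and [Q] is its rational form. *)
pose U := rowsub (maxrankfun A) A.
have rowA i : row i A = a i by rewrite rowK.
have rowU i : row i U = a (maxrankfun A i) by rewrite -rowA row_rowsub.
have Ufree : row_free U by exact: maxrowsub_free.
pose C := A *m pinvmx U.
have AE : A = C *m U by rewrite mulmxKpV// eq_maxrowsub.
have [Q CE] : exists Q : 'M[rat]_(k, _), C = map_mx ratr Q.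
  have /choice[d dE] i : exists d : 'rV[rat]_(\rank A), row i C = map_mx ratr d.
    apply: (lattice_coords_rat lat Ufree) => [j|].
      by rewrite rowU; exact: differences_combs.
    by rewrite -row_mul -AE rowA; exact: differences_combs.
  exists (\matrix_i d i); apply/row_matrixP => i.
  by rewrite dE -map_row rowK.
have combE (m : 'I_k -> nat) :
    \sum_i a i *+ m i = map_mx ratr (\row_i (m i)%:R) *m A.
  rewrite mulmx_sum_row; apply: eq_bigr => i _.
  by rewrite rowA !mxE ratr_nat scaler_nat.
(* [mu] is the difference of the coefficient vectors, so [zeta] gives the rational coordinates of
   [x - y]. *)
pose mu : 'rV[rat]_k := \row_i (mx i)%:R - \row_i (my i)%:R.
have zE : x - y = map_mx ratr mu *m A by rewrite xE yE !combE map_mxB mulmxBl.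
pose zeta := mu *m Q.
have zetaE : x - y = map_mx ratr zeta *m U by rewrite zE map_mxM -CE -mulmxA -AE.
have zeta0 (p : 'cV_(\rank A)) : (forall i, 0 <= (Q *m p) i 0) -> (zeta *m p) 0 0 = 0.
  move=> Qp0; have [N [m [N0 hm]]] := common_denominator_nat Qp0.
  (* The inverse Gram matrix yields the vector of the span whose pairings with the basis are [N p].
     As [N] clears the denominators of [Q p], its pairings with the generators are natural
     numbers. *)
  pose w := map_mx ratr (N%:R *: p)^T *m invmx (U *m U^T) *m U.
  have Uw : U *m w^T = map_mx ratr (N%:R *: p).
    rewrite /w !trmx_mul trmx_inv trmx_mul trmxK !mulmxA mulmxV ?gram_unit//.
    by rewrite mul1mx -map_trmx trmxK.
  have Aw : A *m w^T = map_mx ratr (Q *m (N%:R *: p)).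
    by rewrite map_mxM -CE -Uw mulmxA -AE.
  have dual_w : dual (nat_combs a) w.
    split=> [|_ [m' ->]].
      exists (\rank A), (fun i => (map_mx ratr (N%:R *: p)^T *m invmx (U *m U^T)) 0 i).
      exists (fun i => row i U); split=> [i|]; last exact: mulmx_sum_row.
      by rewrite rowU; exact: nat_combs_gen.
    rewrite dotC dotE combE -mulmxA Aw -map_mxM mxE.
    rewrite -scalemxAr -scalemxAr mxE mxE mulr_sumr rmorph_sum.
    apply: rpred_sum => i _.
    by rewrite mulrCA hm mxE -natrM rmorph_nat; exact: natr_nat.
  have := dxy _ dual_w; move/eqP; rewrite -subr_eq0 -dotNl -dotDl zetaE dotE.
  rewrite -mulmxA Uw -map_mxM mxE fmorph_eq0 -scalemxAr mxE mulf_eq0.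
  by rewrite pnatr_eq0 -[N == 0]negbK -lt0n N0 /= => /eqP.
(* Farkas puts [g] in the rational cone of the rows of [Q]; clearing denominators of the multipliers
   lands in the semigroup. *)
have cone (g : 'rV_(\rank A)) : (forall p : 'cV_(\rank A),
      (forall i, 0 <= (Q *m p) i 0) -> (g *m p) 0 0 = 0) ->
    exists2 N, (0 < N)%N & nat_combs a ((map_mx ratr g *m U) *+ N).
  move=> g0; have [p /g0 ->//|t [t0 ->]] := @farkas _ _ _ Q g.
  have [N [m [N0 hm]]] := common_denominator_nat t0.
  exists N => //; exists m; rewrite combE map_mxM -CE -mulmxA -AE.
  rewrite -scaler_nat scalemxAl; congr (_ *m _); apply/rowP => i.
  by rewrite !mxE -hm rmorphM rmorph_nat.
have [N1 N10 G1] := cone _ zeta0.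
have [|N2 N20 G2] := cone (- zeta).
  by move=> p Qp0; rewrite mulNmx mxE zeta0 ?oppr0.
move: G2; rewrite map_mxN mulNmx -zetaE => G2; rewrite -zetaE in G1.
(* The common multiple [N1 * N2] puts a multiple of [x - y] and its negative in the semigroup. *)
have := pos _ (nat_combsMn N2 G1); rewrite -mulrnA mulnC.
have := nat_combsMn N1 G2; rewrite -mulrnA mulNrn => h /(_ h) /eqP.
rewrite -scaler_nat scaler_eq0 pnatr_eq0 muln_eq0 -!leqn0 leqNgt N20 leqNgt N10 /=.
by rewrite subr_eq0 => /eqP.
Qed.

Lemma dot_span_eq0 (R : realType) (n : nat) (G : set 'rV[R]_n) (u v : 'rV[R]_n) :
  (forall a, G a -> dot a u = 0) -> linear_span G v -> dot v u = 0.
Proof.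
move=> Gu [m [c [w [Gw ->]]]]; rewrite dotE mulmx_suml summxE big1// => i _.
by rewrite -scalemxAl mxE -dotE Gu ?mulr0.
Qed.

(** * The two isomorphisms *)

Theorem lemma3p4 (R : realType) (n : nat) (G : set 'rV[R]_n) (k l : nat)
    (a : 'I_k -> 'rV[R]_n) (b : 'I_l -> 'rV[R]_n) (S : 'M[int]_(k, l))
    (hG : positive_affine_semigroup G)
    (hS : is_slack_matrix G a b S) :
  (exists f : 'rV[R]_n -> 'rV[int]_l,
      semigroup_iso G (row_semigroup S) f /\ forall i, f (a i) = row i S) /\
  (exists g : 'rV[R]_n -> 'cV[int]_k,
      semigroup_iso (dual G) (col_semigroup S) g /\ forall j, g (b j) = col j S).
Proof.
have [/min_gens_nat_combs Ga /min_gens_nat_combs Gb Sab] := hS.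
have SE i j : S i j = Num.floor (dot (a i) (b j)) by rewrite -(Sab i j).2 intrKfloor.
have Gai i : G (a i) by rewrite Ga; exact: nat_combs_gen.
have Gbj j : dual G (b j) by rewrite Gb; exact: nat_combs_gen.
have dual_int x w : G x -> dual G w -> dot x w \is a Num.int.
  by move=> Gx [_ /(_ _ Gx)]; rewrite dotC; exact: intr_nat.
have floor_inj : {in Num.int &, injective (@Num.floor R)}.
  by move=> x y xi yi /(congr1 (fun z => z%:~R : R)); rewrite !floorK.
split.
  (* Pairings of [G] with its dual are integers, so the floor is exact where it matters. *)
  pose f x := \row_j Num.floor (dot x (b j)); exists f.
  have fa i : f (a i) = row i S by apply/rowP => j; rewrite !mxE SE.
  split=> //; rewrite [in semigroup_iso _]Ga; apply: nat_combs_iso => //; rewrite -Ga.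
    move=> x y /set_mem Gx /set_mem Gy; apply/rowP => j; rewrite !mxE dotDl.
    by rewrite floorDzr ?dual_int.
  (* Equal rows mean equal pairings with every [b j], hence with the whole dual. *)
  move=> x y /set_mem Gx /set_mem Gy /rowP fxy.
  apply: (@dual_separates _ _ _ a); rewrite -?Ga// => w; rewrite Gb => -[m ->].
  rewrite dotC [RHS]dotC !dot_comb; apply: eq_bigr => j _.
  congr (_ *+ _); rewrite dotC [RHS]dotC.
  by have := fxy j; rewrite !mxE => /floor_inj; apply; exact: dual_int.
pose g w := \col_i Num.floor (dot (a i) w); exists g.
have gb j : g (b j) = col j S by apply/colP => i; rewrite !mxE SE.
have dotDr u v w : dot u (v + w) = dot u v + dot u w by rewrite dotC dotDl !(dotC u).
split=> //; rewrite [in semigroup_iso _]Gb; apply: nat_combs_iso => //; rewrite -Gb.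
  move=> x y /set_mem Gx /set_mem Gy; apply/colP => i; rewrite !mxE dotDr.
  by rewrite floorDzr ?dual_int.
move=> x y /set_mem Gx /set_mem Gy /colP gxy.
(* [x - y] is orthogonal to [G], hence to its span, which contains [x] and [y]; so it is orthogonal
   to itself. *)
have xy0 v : G v -> dot v (x - y) = 0.
  rewrite Ga => -[m ->]; rewrite dot_comb big1// => i _.
  rewrite dotC dotDl dotNl !(dotC _ (a i)).
  have := gxy i; rewrite !mxE => /floor_inj ->; rewrite ?dual_int//.
  by rewrite subrr mul0rn.
apply/eqP; rewrite -subr_eq0; apply/eqP/dot_eq0; rewrite {1}dotDl dotNl.
by rewrite (dot_span_eq0 xy0 Gx.1) (dot_span_eq0 xy0 Gy.1) subrr.
Qed.
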